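(* Let $\omega:\mathbb{R}^n\to\mathbb{R}$ be a radially symmetric function that is twice differentiable everywhere in $\mathbb{R}^n$ and whose Laplacian $\Delta\omega$ is continuous on $\mathbb{R}^n$. Then $\omega\in C^2(\mathbb{R}^n)$.
   Context: Radially symmetric means that $\omega(x)$ depends only on $|x|$, where $|x|$ is the Euclidean norm. *)

(* Defs.v *)
From mathcomp Require Import all_boot all_order all_algebra.
From mathcomp Require Import all_classical all_reals all_analysis.

Set Implicit Arguments.
Unset Strict Implicit.
Unset Printing Implicit Defensive.
Import Order.TTheory GRing.Theory Num.Theory.
Import numFieldNormedType.Exports.
Local Open Scope classical_set_scope.
Local Open Scope ring_scope.

(* The library norm `|x| on 'rV[R]_n is the sup norm, so the Euclidean norm is
   defined separately.  The sup norm induces the usual topology of R^n, hence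
   the library's [continuous], [derivable] and [differentiable] are the usual
   notions. *)
Definition enorm (R : realType) (n : nat) (x : 'rV[R]_n) : R :=
  Num.sqrt (\sum_(i < n) x ord0 i ^+ 2).

Definition radial (R : realType) (n : nat) (f : 'rV[R]_n -> R) : Prop :=
  forall x y : 'rV[R]_n, enorm x = enorm y -> f x = f y.

Definition unit_vec (R : realType) (n : nat) (i : 'I_n) : 'rV[R]_n :=
  delta_mx ord0 i.

Definition partial (R : realType) (n : nat) (i : 'I_n) (f : 'rV[R]_n -> R) :
    'rV[R]_n -> R :=
  fun x => 'D_(unit_vec R i) f x.

(* Coordinates of the differential 'd f x when f is differentiable at x. *)
Definition gradient (R : realType) (n : nat) (f : 'rV[R]_n -> R) :
    'rV[R]_n -> 'rV[R]_n :=
  fun x => \row_(i < n) partial i f x.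

(* Frechet differentiability of f and of its derivative, the latter being
   identified with the gradient field. *)
Definition twice_differentiable (R : realType) (n : nat)
    (f : 'rV[R]_n -> R) : Prop :=
  (forall x, differentiable f x) /\ (forall x, differentiable (gradient f) x).

Definition laplacian (R : realType) (n : nat) (f : 'rV[R]_n -> R) :
    'rV[R]_n -> R :=
  fun x => \sum_(i < n) partial i (partial i f) x.

(* [partial i f] is a total function, with a junk value where the limit does
   not exist; existence of the partial derivatives is required explicitly. *)
Fixpoint class_C (R : realType) (n : nat) (k : nat) (f : 'rV[R]_n -> R) :
    Prop :=
  match k with
  | 0 => continuous f
  | k'.+1 => [/\ continuous f,
                 (forall i x, derivable f x (unit_vec R i)) &
                 (forall i, class_C k' (partial i f))]
  end.

(* Main.v *)
Require Import Defs.
From mathcomp Require Import all_boot all_order all_algebra.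
From mathcomp Require Import all_classical all_reals all_analysis.
From mathcomp Require Import ring lra.
Import Order.TTheory GRing.Theory Num.Theory.
Import numFieldNormedType.Exports.
Local Open Scope classical_set_scope.
Local Open Scope ring_scope.

(** Write [omega x = g `|x|] and [r = `|x|] (Euclidean norm).  Everything is
    expressed through the radial function [g'(r) / r], called [slope omega]
    below: the gradient is [slope omega x] times [x] ([partial_slope]), and
    differentiating this product gives, for [x != 0], a Hessian of the form
    [slope * I + c *: x x^T].  Taking traces determines [c] from the Laplacian:
    the Hessian entries are
      [(k == i) * slope + (x_i x_k / r ^ 2) * (laplacian - n * slope)]
    ([partial2_laplacian]).  Away from the origin [slope] is differentiable and
    the Laplacian is continuous by assumption, so the entries are continuous
    there.

    At the origin the Hessian is [a * I] with [a = g''(0)], and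
    [g'(r) / r --> g''(0)] merely because [g'] is differentiable at [0]
    ([cvg_slope0]).  Hence [laplacian - n * slope] tends to
    [n * a - n * a = 0]; as its coefficient [x_i x_k / r ^ 2] is bounded, the
    displayed formula tends to [(k == i) * a], the value at the origin.

    The profile [g] is never introduced, which avoids differentiating the norm.
    What replaces the chain rule is that [t |-> f (x + t v)] is even whenever
    [f] is radial and [v] is orthogonal to [x], so that [f] has zero derivative
    in the directions orthogonal to [x] ([derive_radial_orth]).  This is
    applied to [omega] and again to [slope omega], which is radial too. *)

Set Implicit Arguments.
Unset Strict Implicit.
Unset Printing Implicit Defensive.

(** * The Euclidean norm *)

Definition sqnorm (R : realType) (n : nat) (x : 'rV[R]_n) : R :=
  \sum_(i < n) x ord0 i ^+ 2.

Lemma sqnorm_ge0 (R : realType) (n : nat) (x : 'rV[R]_n) : 0 <= sqnorm x.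
Proof. by apply: sumr_ge0 => i _; exact: sqr_ge0. Qed.

Lemma sqnorm_eq0 (R : realType) (n : nat) (x : 'rV[R]_n) :
  (sqnorm x == 0) = (x == 0).
Proof.
apply/idP/eqP => [|->]; last first.
  by rewrite /sqnorm big1// => i _; rewrite mxE expr0n.
rewrite psumr_eq0; last by move=> i _; exact: sqr_ge0.
move=> /allP x0; apply/rowP => i; rewrite mxE; apply/eqP.
by rewrite -sqrf_eq0; apply: x0; rewrite mem_index_enum.
Qed.

Lemma enorm_sqnorm (R : realType) (n : nat) (x y : 'rV[R]_n) :
  enorm x = enorm y <-> sqnorm x = sqnorm y.
Proof.
split=> [|xy]; last by rewrite /enorm -/(sqnorm x) xy.
by move=> /eqP; rewrite eqr_sqrt ?sqnorm_ge0// => /eqP.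
Qed.

Lemma sqnormZ (R : realType) (n : nat) (a : R) (x : 'rV[R]_n) :
  sqnorm (a *: x) = a ^+ 2 * sqnorm x.
Proof. by rewrite mulr_sumr; apply: eq_bigr => i _; rewrite mxE exprMn. Qed.

Lemma sqnorm_unit_vec (R : realType) (n : nat) (i : 'I_n) :
  sqnorm (unit_vec R i) = 1.
Proof.
rewrite /sqnorm (bigD1 i)//= big1 => [|j ji]; rewrite !mxE ?eqxx ?expr1n ?addr0//.
by rewrite (negbTE ji) andbF expr0n.
Qed.

Lemma unit_vecE (R : realType) (n : nat) (i j : 'I_n) :
  unit_vec R i ord0 j = (i == j)%:R.
Proof. by rewrite mxE eqxx eq_sym. Qed.

Lemma enormZ_unit_vec (R : realType) (n : nat) (i : 'I_n) (t : R) :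
  enorm (t *: unit_vec R i) = `|t|.
Proof.
by rewrite /enorm -/(sqnorm _) sqnormZ sqnorm_unit_vec mulr1 sqrtr_sqr.
Qed.

Lemma differentiable_sqnorm (R : realType) (n : nat) (x : 'rV[R]_n) :
  differentiable (@sqnorm R n) x.
Proof.
rewrite (_ : @sqnorm R n = \sum_(i < n) (fun y : 'rV[R]_n => y ord0 i) ^+ 2).
  apply: differentiable_sum => i; apply: differentiableX.
  exact: differentiable_coord.
by apply/funext => y; rewrite fct_sumE.
Qed.

Lemma enorm_continuous (R : realType) (n : nat) : continuous (@enorm R n).
Proof.
move=> x; apply: continuous_comp; last exact: sqrt_continuous.
exact/differentiable_continuous/differentiable_sqnorm.
Qed.

(** The punctured neighbourhood is preserved because the norm vanishes only at
    the origin; limits of radial functions at the origin thereby reduce to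
    limits in one real variable. *)
Lemma enorm_dnbhs0 (R : realType) (n : nat) :
  @enorm R n x @[x --> (0 : 'rV[R]_n)^'] --> (0 : R)^'.
Proof.
have e0 : enorm (0 : 'rV[R]_n) = 0.
  by apply/eqP; rewrite /enorm -/(sqnorm _) sqrtr_eq0 le_eqVlt sqnorm_eq0 eqxx.
have c0 : @enorm R n x @[x --> (0 : 'rV[R]_n)] --> (0 : R).
  by rewrite -[X in _ --> X]e0; exact: enorm_continuous.
move=> A A0.
have {}A0 : \forall x \near (0 : 'rV[R]_n), enorm x != 0 -> A (enorm x).
  exact: c0 A0.
change (\forall x \near (0 : 'rV[R]_n), x != 0 -> A (enorm x)).
apply: filterS A0 => x /= Ax x0; apply: Ax.
by rewrite /enorm -/(sqnorm _) sqrtr_eq0 -ltNge lt_neqAle sqnorm_ge0 eq_sym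
  sqnorm_eq0 x0.
Qed.

Lemma coordM_le_sqnorm (R : realType) (n : nat) (x : 'rV[R]_n) (i k : 'I_n) :
  `|x ord0 i * x ord0 k / sqnorm x| <= 1.
Proof.
have [->|x0] := eqVneq x 0; first by rewrite mxE !mul0r normr0.
have x2 : 0 < sqnorm x by rewrite lt_neqAle eq_sym sqnorm_eq0 x0 sqnorm_ge0.
have le_sq (j : 'I_n) : x ord0 j ^+ 2 <= sqnorm x.
  by rewrite /sqnorm (bigD1 j)//= lerDl sumr_ge0// => l _; exact: sqr_ge0.
rewrite normrM normfV (gtr0_norm x2) ler_pdivrMr// mul1r.
have := le_sq i; have := le_sq k.
have := sqr_ge0 (x ord0 i - x ord0 k); have := sqr_ge0 (x ord0 i + x ord0 k).
rewrite ler_norml => *; apply/andP; split; nra.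
Qed.

(** * Directional derivatives *)

(** Equality of difference quotients, at possibly different points and in
    different directions: this is how symmetries of a function are transferred
    to its derivatives. *)
Lemma eq_derive (R : realType) (V W : normedModType R) (f g : V -> W)
    (x y v w : V) :
  (forall h : R, f (h *: v + x) - f x = g (h *: w + y) - g y) ->
  'D_v f x = 'D_w g y.
Proof.
move=> fg; rewrite /derive.
by under eq_fun do rewrite /= fg.
Qed.

Lemma derive_partial (R : realType) (n : nat) (f : 'rV[R]_n -> R)
    (x v : 'rV[R]_n) : differentiable f x ->
  'D_v f x = \sum_(i < n) v ord0 i * partial i f x.
Proof.
move=> df; rewrite deriveE// {1}(row_sum_delta v) linear_sum.
by apply: eq_bigr => i _; rewrite linearZ /partial deriveE.
Qed.

Lemma derive_coord (R : realType) (n : nat) (i : 'I_n) (x v : 'rV[R]_n) :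
  'D_v (fun y : 'rV[R]_n => y ord0 i) x = v ord0 i.
Proof.
rewrite -[in RHS](derive_id x v) derive_mx; last exact: derivable_id.
by rewrite mxE.
Qed.

Lemma differentiable_partial (R : realType) (n : nat) (f : 'rV[R]_n -> R)
    (i : 'I_n) (x : 'rV[R]_n) :
  differentiable (gradient f) x -> differentiable (partial i f) x.
Proof.
move=> dg.
rewrite (_ : partial i f = (fun y : 'rV[R]_n => y ord0 i) \o gradient f).
  exact: differentiable_comp dg (differentiable_coord _ _ _).
by apply/funext => y /=; rewrite mxE.
Qed.

(** * Radial functions *)

(** As [x] and [v] are orthogonal, [x + h v] and [x - h v] have the same norm,
    so the derivatives of [f] along [v] and [- v] agree; by linearity they are
    also opposite. *)
Lemma derive_radial_orth (R : realType) (n : nat) (f : 'rV[R]_n -> R)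
    (x v : 'rV[R]_n) : radial f -> differentiable f x ->
  \sum_(i < n) x ord0 i * v ord0 i = 0 -> 'D_v f x = 0.
Proof.
move=> rf df xv.
have expand (h : R) : sqnorm (h *: v + x) = h ^+ 2 * sqnorm v + sqnorm x.
  transitivity (h ^+ 2 * sqnorm v + sqnorm x +
                2 * h * \sum_(i < n) x ord0 i * v ord0 i); last first.
    by rewrite xv mulr0 addr0.
  rewrite /sqnorm !mulr_sumr -!big_split/=.
  by apply: eq_bigr => i _; rewrite !mxE; ring.
have sym (h : R) : f (h *: v + x) = f (h *: - v + x).
  apply: rf; apply: (proj2 (enorm_sqnorm _ _)).
  by rewrite scalerN -scaleNr !expand sqrrN.
have : 'D_v f x = 'D_(- v) f x.
  by apply: eq_derive => h; rewrite sym.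
rewrite [RHS]deriveE// linearN -deriveE// => /eqP.
by rewrite -subr_eq0 opprK -mulr2n mulrn_eq0/= => /eqP.
Qed.

(** The gradient is parallel to [x].  The vector [sqnorm x *: e_i - x_i *: x],
    a multiple of the component of [e_i] orthogonal to [x], is a direction in
    which the derivative vanishes. *)
Lemma partial_radial (R : realType) (n : nat) (f : 'rV[R]_n -> R)
    (i : 'I_n) (x : 'rV[R]_n) : radial f -> differentiable f x ->
  sqnorm x * partial i f x = x ord0 i * 'D_x f x.
Proof.
move=> rf df; apply/eqP; rewrite -subr_eq0; apply/eqP.
rewrite -(derive_radial_orth (v := sqnorm x *: unit_vec R i - x ord0 i *: x)
  rf df).
  by rewrite [RHS]deriveE// linearB !linearZ -!deriveE.
under eq_bigr do rewrite !mxE mulrBr !mulrA.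
rewrite sumrB (bigD1 i)//= !eqxx big1/=; last first.
  by move=> j /negbTE ->; rewrite mulr0.
by rewrite addr0 mulr1 /sqnorm mulr_sumr -sumrB big1// => j _; ring.
Qed.

(** The difference quotients of [f] at [x] along [x] only involve the values of
    [f] at multiples of [x], which depend on [x] through its norm. *)
Lemma radial_derive (R : realType) (n : nat) (f : 'rV[R]_n -> R) :
  radial f -> radial (fun x => 'D_x f x).
Proof.
move=> rf x y xy; apply: eq_derive => h; congr (_ - _); apply: rf => //.
have scale z : h *: z + z = (h + 1) *: z by rewrite scalerDl scale1r.
apply: (proj2 (enorm_sqnorm _ _)); rewrite !scale !sqnormZ.
by rewrite (proj1 (enorm_sqnorm _ _) xy).
Qed.

(** If [f x = g r] with [r] the Euclidean norm of [x], then ['D_x f x] is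
    [r * g'(r)], so this is [g'(r) / r]; its value at [0] is [0 / 0 = 0] and
    not the limit [g''(0)]. *)
Definition slope (R : realType) (n : nat) (f : 'rV[R]_n -> R)
  (x : 'rV[R]_n) : R := 'D_x f x / sqnorm x.

Lemma radial_slope (R : realType) (n : nat) (f : 'rV[R]_n -> R) :
  radial f -> radial (slope f).
Proof.
move=> rf x y xy; rewrite /slope (radial_derive rf xy).
by rewrite (proj1 (enorm_sqnorm _ _) xy).
Qed.

(** This also holds at the origin, where the gradient of a radial function
    vanishes since every direction is orthogonal to [0].  It is thus an
    identity between functions, to which the product rule and difference
    quotients at the origin can both be applied. *)
Lemma partial_slope (R : realType) (n : nat) (f : 'rV[R]_n -> R)
    (i : 'I_n) (x : 'rV[R]_n) : radial f -> differentiable f x ->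
  partial i f x = x ord0 i * slope f x.
Proof.
move=> rf; have [->|x0] := eqVneq x 0 => df; last first.
  have x2 : sqnorm x != 0 by rewrite sqnorm_eq0.
  by apply: (mulfI x2); rewrite partial_radial// /slope; field.
have -> : partial i f 0 = 0.
  apply: derive_radial_orth => //.
  by rewrite big1// => j _; rewrite mxE mul0r.
by rewrite mxE mul0r.
Qed.

Lemma differentiable_slope (R : realType) (n : nat) (f : 'rV[R]_n -> R)
    (x : 'rV[R]_n) : twice_differentiable f -> x != 0 ->
  differentiable (slope f) x.
Proof.
move=> [df dg] x0.
rewrite (_ : slope f =
    (\sum_(i < n) (fun y : 'rV[R]_n => y ord0 i) * partial i f) *
    (fun y => (sqnorm y)^-1)).
  apply: differentiableM.
    apply: differentiable_sum => i; apply: differentiableM.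
      exact: differentiable_coord.
    exact: differentiable_partial.
  by apply: differentiableV; [exact: differentiable_sqnorm|rewrite sqnorm_eq0].
by apply/funext => y; rewrite /slope derive_partial// fctE fct_sumE.
Qed.

(** * The Hessian of a radial function *)

(** Product rule on [partial_slope]; the gradient of the radial function
    [slope f] is again parallel to [x]. *)
Lemma partial2_slope (R : realType) (n : nat) (f : 'rV[R]_n -> R)
    (i k : 'I_n) (x : 'rV[R]_n) :
  radial f -> twice_differentiable f -> x != 0 ->
  partial k (partial i f) x =
  (k == i)%:R * slope f x +
  x ord0 i * x ord0 k / sqnorm x * 'D_x (slope f) x.
Proof.
move=> rf d2f x0; have ds := differentiable_slope d2f x0.
have x2 : sqnorm x != 0 by rewrite sqnorm_eq0.
rewrite /partial -/(partial i f).
rewrite (_ : partial i f = (fun y : 'rV[R]_n => y ord0 i) * slope f);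
  last by apply/funext => y; rewrite partial_slope//; exact: d2f.1.
rewrite deriveM; [|exact/diff_derivable/differentiable_coord
                  |exact: diff_derivable].
rewrite derive_coord unit_vecE addrC [slope f x *: _]mulrC; congr (_ + _).
rewrite [LHS](_ : _ = x ord0 i * (sqnorm x * partial k (slope f) x) / sqnorm x);
  last by rewrite /partial /GRing.scale/=; field.
rewrite partial_radial//; last exact: radial_slope.
by ring.
Qed.

Lemma laplacian_slope (R : realType) (n : nat) (f : 'rV[R]_n -> R)
    (x : 'rV[R]_n) :
  radial f -> twice_differentiable f -> x != 0 ->
  laplacian f x = n%:R * slope f x + 'D_x (slope f) x.
Proof.
move=> rf d2f x0; rewrite /laplacian.
under eq_bigr do rewrite partial2_slope// eqxx mul1r.
rewrite big_split/= sumr_const card_ord mulr_natl -!mulr_suml.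
rewrite -[\sum_(i < n) _]/(sqnorm x).
by rewrite divff ?sqnorm_eq0// mul1r.
Qed.

(** Taking the trace shows that the derivative of [slope f] along [x], a priori
    uncontrolled near the origin, is a combination of the Laplacian and of
    [slope f] itself. *)
Lemma partial2_laplacian (R : realType) (n : nat) (f : 'rV[R]_n -> R)
    (i k : 'I_n) (x : 'rV[R]_n) :
  radial f -> twice_differentiable f -> x != 0 ->
  partial k (partial i f) x =
  (k == i)%:R * slope f x +
  x ord0 i * x ord0 k / sqnorm x * (laplacian f x - n%:R * slope f x).
Proof.
move=> rf d2f x0.
by rewrite laplacian_slope// addrAC subrr add0r partial2_slope.
Qed.

(** On the [k]-th axis, [partial i f] is zero if [k != i], as it equals [x_i]
    times the slope; if [k = i] it is a function of the coordinate which, by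
    radial symmetry, is the same for all axes. *)
Lemma partial2_radial0 (R : realType) (n : nat) (f : 'rV[R]_n -> R)
    (i j k : 'I_n) : radial f -> (forall x, differentiable f x) ->
  partial k (partial i f) 0 = (k == i)%:R * partial j (partial j f) 0.
Proof.
move=> rf df; have [->|ki] := eqVneq k i.
  rewrite mul1r; apply: eq_derive => h.
  rewrite !addr0 !partial_slope// !mxE !eqxx !mul0r !subr0.
  congr (_ * _); apply: radial_slope => //.
  by rewrite !enormZ_unit_vec.
rewrite mul0r -[RHS](derive_cst (0 : R) 0 (unit_vec R k)).
apply: eq_derive => h; rewrite addr0 !partial_slope// subrr.
by rewrite mxE unit_vecE (negbTE ki) mxE mulr0 !mul0r subrr.
Qed.

(** On the [i]-th axis [slope f (t *: e_i)] is [partial i f (t *: e_i) / t],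
    that is, the difference quotient at [0] of [partial i f]; radial symmetry
    extends the limit along one axis to a limit in all directions. *)
Lemma cvg_slope0 (R : realType) (n : nat) (f : 'rV[R]_n -> R) (i : 'I_n) :
  radial f -> twice_differentiable f ->
  slope f x @[x --> (0 : 'rV[R]_n)^'] --> partial i (partial i f) 0.
Proof.
move=> rf [df dg].
pose g (t : R) := slope f (t *: unit_vec R i).
have -> : slope f = g \o @enorm R n.
  apply/funext => x /=; apply: radial_slope => //.
  by rewrite enormZ_unit_vec ger0_norm// sqrtr_ge0.
suff g0 : g t @[t --> (0 : R)^'] --> partial i (partial i f) 0.
  exact: (@cvg_comp _ _ _ (@enorm R n) g _ _ _ (@enorm_dnbhs0 R n) g0).
have : derivable (partial i f) 0 (unit_vec R i).
  by apply: diff_derivable; exact: differentiable_partial.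
rewrite /partial -/(partial i f) /derive /derivable.
move=> dif; apply: cvg_trans dif; apply: near_eq_cvg.
near=> t.
have t0 : t != 0 by near: t; exact: nbhs_dnbhs_neq.
rewrite /= addr0 !partial_slope// mxE unit_vecE eqxx mxE mul0r subr0 mulr1.
by rewrite /GRing.scale/= mulrA mulVf// mul1r.
Unshelve. all: by end_near. Qed.

Lemma cvg0_bounded_mul (R : realType) (T : Type) (F : set_system T)
    (c g : T -> R) : Filter F -> (forall x, `|c x| <= 1) ->
  g x @[x --> F] --> 0 -> c x * g x @[x --> F] --> 0.
Proof.
move=> FF c1 /cvgr0Pnorm_lt g0; apply/cvgr0Pnorm_lt => e e0.
near=> x; rewrite normrM; apply: (@le_lt_trans _ _ `|g x|).
  by rewrite ler_piMl.
by near: x; exact: g0.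
Unshelve. all: by end_near. Qed.

(** * Continuity of the Hessian *)

(** At the origin only the punctured limit has to be computed, so that the
    formula for the Hessian away from the origin serves there too; its singular
    coefficient is compensated by [laplacian f - n * slope f] tending to [0]. *)
Lemma partial2_continuous (R : realType) (n : nat) (f : 'rV[R]_n -> R)
    (i k : 'I_n) : radial f -> twice_differentiable f ->
  continuous (laplacian f) -> continuous (partial k (partial i f)).
Proof.
move=> rf d2f lapc x.
pose F (y : 'rV[R]_n) := (k == i)%:R * slope f y +
  y ord0 i * y ord0 k / sqnorm y * (laplacian f y - n%:R * slope f y).
have FE (G : set_system 'rV[R]_n) : Filter G -> (\forall y \near G, y != 0) ->
    partial k (partial i f) y @[y --> G] `=>` F y @[y --> G].
  move=> FG G0; apply: near_eq_cvg; near=> y.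
  by rewrite partial2_laplacian//; near: y.
have [->|x0] := eqVneq x 0; last first.
  have cs : slope f y @[y --> x] --> slope f x.
    exact/differentiable_continuous/differentiable_slope.
  have cc (j : 'I_n) : (y : 'rV[R]_n) ord0 j @[y --> x] --> x ord0 j.
    exact: coord_continuous.
  rewrite /continuous_at partial2_laplacian//.
  have nx : \forall y \near x, y != 0.
    exact: (@cvgr_neq0 R _ _ (nbhs x) _ id x (@cvg_id _ _) x0).
  apply: cvg_trans (FE _ _ nx) _.
  apply: cvgD; first exact: cvgM (cvg_cst _) cs.
  apply: cvgM; last exact: cvgB (lapc x) (cvgM (cvg_cst _) cs).
  apply: cvgM; first exact: cvgM (cc i) (cc k).
  apply: cvgV; first by rewrite sqnorm_eq0.
  exact/differentiable_continuous/differentiable_sqnorm.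
apply/continuous_withinNx.
apply: cvg_trans (FE _ _ (nbhs_dnbhs_neq (0 : 'rV[R]_n))) _.
have cs := cvg_slope0 (i := i) rf d2f.
have lap0 : laplacian f 0 = n%:R * partial i (partial i f) 0.
  rewrite /laplacian; under eq_bigr => j _.
    rewrite (partial2_radial0 _ i _ rf)//; last exact: d2f.1.
    rewrite eqxx mul1r; over.
  by rewrite sumr_const card_ord mulr_natl.
rewrite (partial2_radial0 _ i _ rf)//; last exact: d2f.1.
rewrite -[(k == i)%:R * _]addr0.
apply: cvgD; first exact: cvgM (cvg_cst _) cs.
apply: cvg0_bounded_mul => [y|]; first exact: coordM_le_sqnorm.
(* the trace of the Hessian at the origin cancels n times the limit of slope *)
rewrite -(subrr (laplacian f 0)) {2}lap0.
apply: cvgB; last exact: cvgM (cvg_cst _) cs.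
by apply/continuous_withinNx; exact: lapc.
Unshelve. all: by end_near. Qed.

Theorem proposition1p1 (R : realType) (n : nat) (omega : 'rV[R]_n -> R)
  (omega_radial : radial omega)
  (omega_diff2 : twice_differentiable omega)
  (laplacian_cont : continuous (laplacian omega)) :
  class_C 2 omega.
Proof.
have [df dg] := omega_diff2.
split=> [x|i x|i]; first exact: differentiable_continuous.
  exact: diff_derivable.
have dp x := differentiable_partial i (dg x).
split=> [x|k x|k]; first exact: differentiable_continuous.
  exact: diff_derivable.
exact: partial2_continuous.
Qed.
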